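(* For every fixed real $\varepsilon > 0$ there exists $q_0 = q_0(\varepsilon)$ such that the following holds for every integer $q \ge q_0$ and every integer $a$ with $\gcd(a,q) = 1$. For any integer $Q \ge q^{2+\varepsilon}$ there are integers $a_1, a_2, a_3, a_4$ and integers $q_1, q_2, q_3, q_4$ with $1 \le q_i \le 2 Q^{1/4}$ for $i = 1, 2, 3, 4$, such that $$ \left| \frac{a}{q} - \frac{a_1}{q_1} - \frac{a_2}{q_2} - \frac{a_3}{q_3} - \frac{a_4}{q_4}\right| \le \frac{1}{qQ}. $$
   Context: The numerators $a_1, a_2, a_3, a_4$ are arbitrary integers (they may be negative or zero). ''Sufficiently large $q$'' means that $q$ exceeds a bound depending only on $\varepsilon$. *)

(* Defs.v *)
From mathcomp Require Export all_boot all_order all_algebra.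
From mathcomp Require Export reals exp.

(* Main.v *)
Require Import Defs.
From mathcomp Require Import all_boot all_order all_algebra.
From mathcomp Require Import reals exp.
From mathcomp Require Import zify ring lra.
Import Order.TTheory GRing.Theory Num.Theory.
Set Implicit Arguments.
Unset Strict Implicit.
Unset Printing Implicit Defensive.

(** Put X = Q^(1/4) and Y = floor X; if q <= 2X there is nothing to do.
    Otherwise it suffices to find distinct primes p1, p2, p3 and an integer
    x < p1, p2, p3, all in (Y, 2Y], with a p1 p2 p3 x = 1 mod q: then a/q
    differs by exactly 1/(q p1 p2 p3 x) <= 1/(qQ) from a fraction of denominator
    p1 p2 p3 x, which splits into partial fractions.

    Let N(w) be the number of (p, x), p in a set of K primes and x in an interval
    of M integers, with p x = w mod q.  The second moment of N counts the
    solutions of p x = p' x' mod q.  If h is least with p s = p' h mod q for some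
    |s| <= S, cutting the range of x' into blocks of length h shows that there are
    at most (M/h + 1)(h(M + S)/q + 1) of them, which is close to M^2/q unless h
    is small; and a small h is rare, because p' and h leave few choices for the
    product p s, hence for p.  So the variance of N is small and N vanishes on few
    residues, too few to contain every c/(p2 p3) mod q, where c = 1/a.  Chebyshev's
    lower bound for the number of primes in (Y, 2Y] makes K large enough as soon
    as Y^2 >= q (log q)^16, up to a constant. *)

(** * Primes between n and 2n *)

Lemma prod_primes_dvdn (s : seq nat) (n : nat) :
  uniq s -> (forall p, p \in s -> prime p /\ p %| n) -> \prod_(p <- s) p %| n.
Proof.
elim: s => [|p s IHs] /=; first by rewrite big_nil dvd1n.
case/andP=> ps us H; rewrite big_cons Gauss_dvd.
  have [_ ->] := H p (mem_head _ _); apply: IHs => // r rs.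
  by apply: H; rewrite inE rs orbT.
have [pp _] := H p (mem_head _ _).
rewrite big_seq; elim/big_ind: _ => [|x y cx cy|r rs].
- exact: coprimen1.
- by rewrite coprimeMr cx.
have [pr _] := H r (@mem_behead _ (p :: s) r rs).
rewrite prime_coprime // dvdn_prime2 //; apply: contra ps => /eqP ->//.
Qed.

Lemma prime_dvd_fact p n : prime p -> (p %| n`!) = (p <= n).
Proof.
move=> pp; apply/idP/idP => [|pn]; last by rewrite dvdn_fact // prime_gt0.
elim: n => [|n IHn]; first by rewrite fact0 Euclid_dvd1.
by rewrite factS Euclid_dvdM // => /orP[/dvdn_leq->|/IHn/leqW].
Qed.

(** The coefficients at [n] and [n + 1] are equal and both occur in the expansion of [2 ^ (2n + 1)],
    so each is at most half of it. *)
Lemma bin_middle_odd n : 'C(n.*2.+1, n) <= 4 ^ n.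
Proof.
have : 'C(n.*2.+1, n) + 'C(n.*2.+1, n.+1) <= 2 ^ n.*2.+1.
  have n1 : n < n.*2.+2 by lia.
  have n2 : n.+1 < n.*2.+2 by lia.
  have -> : 2 ^ n.*2.+1 = \sum_(i < n.*2.+2) 'C(n.*2.+1, i).
    by rewrite (expnDn 1 1); apply: eq_bigr => i _; rewrite !exp1n !muln1.
  rewrite (bigD1 (Ordinal n1)) //= (bigD1 (Ordinal n2)) /=; first by lia.
  by rewrite -val_eqE /=; lia.
have -> : 'C(n.*2.+1, n.+1) = 'C(n.*2.+1, n).
  rewrite -bin_sub; last by lia.
  by congr 'C(_, _); lia.
by rewrite expnS -muln2 mulnC expnM -[2 ^ 2]/4; lia.
Qed.

(** Induction of Erdős. An even [n > 2] adds no factor. For [n = 2k + 1] the primes in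
    [(k + 1, 2k + 1]] all divide ['C(2k + 1, k)], which is at most [4 ^ k], and the bound at [k + 1]
    covers the rest. *)
Lemma primorial_le n : \prod_(0 <= p < n.+1 | prime p) p <= 4 ^ n.
Proof.
elim/ltn_ind: n => n IHn.
case: (ltnP n 3) => [|n3].
  by case: n IHn => [|[|[|]]] // _ _; rewrite unlock.
have [on|en] := boolP (odd n); last first.
  rewrite big_mkcond big_nat_recr //= -big_mkcond /=.
  have -> : prime n = false.
    apply/negP => pn; case: (even_prime pn) => [n2|]; first by lia.
    by rewrite (negPf en).
  rewrite muln1; have -> : n = n.-1.+1 by lia.
  apply: leq_trans (IHn _ _) _; first by lia.
  by rewrite leq_exp2l.
have [k nE] : exists k, n = k.*2.+1 by exists n./2; lia.
rewrite nE (@big_cat_nat _ _ _ k.+2) //=; last by lia.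
apply: (@leq_trans (4 ^ k.+1 * 4 ^ k)); last first.
  by rewrite -expnD leq_exp2l //; lia.
apply: leq_mul; first by apply: IHn; lia.
apply: leq_trans (bin_middle_odd k).
apply: dvdn_leq; first by rewrite bin_gt0; lia.
rewrite -big_filter; apply: prod_primes_dvdn => [|p].
  by rewrite filter_uniq // iota_uniq.
rewrite mem_filter mem_index_iota => /and3P[pp lp pu]; split=> //.
have : p %| (k.*2.+1)`! by rewrite prime_dvd_fact.
rewrite -(@bin_fact _ k); last by lia.
rewrite !Euclid_dvdM // !prime_dvd_fact //.
by case/or3P=> //; lia.
Qed.

(** The central coefficient grows by the factor [2(2n + 1)/(n + 1)]; passing from [2n + 1] to
    [2n + 3] makes up for what this lacks to 4. *)
Lemma central_bin_ge n : 4 ^ n <= n.*2.+1 * 'C(n.*2, n).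
Proof.
elim: n => // n IHn.
have E1 : n.+1 * 'C(n.*2.+2, n.+1) = n.*2.+2 * 'C(n.*2.+1, n).
  by rewrite -mul_bin_diag.
have E2 : n.+1 * 'C(n.*2.+1, n) = n.*2.+1 * 'C(n.*2, n).
  have := mul_bin_down n.*2.+1 n.
  have -> : n.*2.+1 - n = n.+1 by lia.
  by move=> /= ->.
rewrite expnS doubleS.
have H : 4 * 4 ^ n * n.+1 <= n.*2.+3 * 'C(n.*2.+2, n.+1) * n.+1.
  by nia.
by rewrite leq_pmul2r in H.
Qed.

(** By Legendre's formula the exponent is the sum over [k] of [floor(2n/p^k) - 2 floor(n/p^k)]; each
    term is at most 1 and vanishes once [p^k > 2n]. *)
Lemma prime_pow_central_bin p n : 0 < n -> prime p ->
  p ^ logn p 'C(n.*2, n) <= n.*2.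
Proof.
move=> n0 pp; have p1 := prime_gt1 pp.
apply: leq_trans (trunc_logP p1 _); last by lia.
rewrite leq_exp2l //.
have := congr1 (logn p) (@bin_fact n.*2 n ltac:(lia)).
rewrite !lognM ?muln_gt0 ?fact_gt0 ?bin_gt0 ?leq_addr //; try lia.
have -> : n.*2 - n = n by lia.
rewrite !logn_fact // => E.
set t := trunc_log p n.*2.
have tn : t < n.*2.+1.
  rewrite ltnS; apply: leq_trans (trunc_logP p1 _); last by lia.
  by apply: ltnW; exact: ltn_expl.
(* Terms beyond [t] are zero, so the Legendre sums of [n] and of [2n] can run over the same
   range. *)
have S m : m <= n.*2 ->
    \sum_(1 <= k < m.+1) m %/ p ^ k = \sum_(1 <= k < t.+1) m %/ p ^ k.
  move=> mn; have Z a b : t < a -> \sum_(a <= k < b) m %/ p ^ k = 0.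
    move=> ta; rewrite big_nat big1 // => k /andP[ak _].
    rewrite divn_small //; apply: leq_ltn_trans mn _.
    apply: leq_trans (trunc_log_ltn _ p1) _.
    by rewrite leq_exp2l //; apply: leq_trans ta _.
  case: (leqP t m) => tm.
    by rewrite (@big_cat_nat _ _ _ t.+1) //= (Z t.+1) // addn0.
  rewrite [RHS](@big_cat_nat _ _ _ m.+1) //=; last by lia.
  rewrite -[LHS]addn0; congr (_ + _); apply/esym.
  rewrite big_nat big1 // => k /andP[mk _].
  rewrite divn_small //; apply: leq_trans mk _.
  by apply: ltnW; exact: ltn_expl.
rewrite !S // in E; last by lia.
suff : \sum_(1 <= k < t.+1) n.*2 %/ p ^ k <=
       \sum_(1 <= k < t.+1) (n %/ p ^ k + n %/ p ^ k + 1).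
  rewrite !big_split /= sum_nat_const_nat; lia.
apply: leq_sum => k _.
have pk : 0 < p ^ k by rewrite expn_gt0; lia.
have := divn_eq n (p ^ k); have := ltn_pmod n pk.
set a := n %/ _; set b := n %% _ => bl nE.
rewrite -addnn {1}nE -ltnS ltn_divLR //; nia.
Qed.

Definition primes_in (m n : nat) : seq nat :=
  [seq p <- index_iota m.+1 n.+1 | prime p].

Lemma prod_le_exp (s : seq nat) (P : pred nat) (F : nat -> nat) (B : nat) :
  (forall p, p \in s -> P p -> F p <= B) ->
  \prod_(p <- s | P p) F p <= B ^ count P s.
Proof.
elim: s => [|p s IHs] H; first by rewrite big_nil.
have IH := IHs (fun r rs => H r (@mem_behead _ (p :: s) r rs)).
rewrite big_cons /=; case: ifP => // Pp.
by rewrite add1n expnS leq_mul // H // mem_head.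
Qed.

(** The two copies of [n!] already use up the at most two factors [p] of [(2n)!]. *)
Lemma logn_central_bin0 p n : prime p -> p <= n -> n.*2 < p * 3 ->
  n.*2 < p ^ 2 -> logn p 'C(n.*2, n) = 0.
Proof.
move=> pp pn p3 p2; have p0 := prime_gt0 pp.
have := congr1 (logn p) (@bin_fact n.*2 n ltac:(lia)).
have -> : n.*2 - n = n by lia.
rewrite !lognM ?muln_gt0 ?fact_gt0 ?bin_gt0 //; last by lia.
have f1 : 0 < logn p n`! by rewrite logn_gt0 mem_primes pp fact_gt0 prime_dvd_fact.
have : logn p (n.*2)`! <= 2.
  rewrite logn_fact // big_ltn; last by lia.
  rewrite big_nat big1 => [|k /andP[k2 _]].
    by rewrite addn0 expn1 -ltnS ltn_divLR // mulnC.
  rewrite divn_small //; apply: leq_trans p2 _.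
  by rewrite leq_exp2l // prime_gt1.
lia.
Qed.

(** In the factorization of ['C(2n, n)] the primes up to [s] and those in [(n, 2n]] contribute at
    most [2n] each. A prime in [(s, n]] has exponent at most 1, and exponent 0 beyond [2n/3], so
    these are bounded by a primorial. *)
Lemma chebyshev n s : 0 < n -> n.*2 < s.+1 ^ 2 ->
  4 ^ n <= n.*2.+1 * (n.*2 ^ (s + size (primes_in n n.*2)) * 4 ^ (n.*2 %/ 3)).
Proof.
move=> n0 sn; set m := n.*2 %/ 3; have mn : m <= n.*2 by exact: leq_div.
 apply: leq_trans (central_bin_ge n) _.
rewrite leq_mul2l; apply/orP; right.
set C := 'C(_, _).
have C0 : 0 < C by rewrite bin_gt0; lia.
have CE : C = \prod_(0 <= p < n.*2.+1 | prime p) p ^ logn p C.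
  have le p : prime p -> p %| C -> p <= n.*2.
    move=> pp pC; rewrite -(prime_dvd_fact _ pp).
    by rewrite -(@bin_fact n.*2 n) ?dvdn_mulr //; lia.
  rewrite {1}[C]prod_prime_decomp // prime_decompE big_map /=.
  rewrite -[RHS]big_filter -[RHS](@big_rmcond_in _ _ _ _ _ (fun p => p %| C)).
    rewrite -[RHS]big_filter; apply: perm_big; apply: uniq_perm.
    - exact: primes_uniq.
    - by rewrite !filter_uniq // iota_uniq.
    move=> p; rewrite !mem_filter mem_index_iota mem_primes C0 /=.
    apply/idP/idP; first by case/andP=> pp pC; rewrite pp pC ltnS le.
    by case/and3P=> -> ->.
  move=> p; rewrite mem_filter => /andP[pp _] npC.
  by rewrite lognE pp C0 (negPf npC).
rewrite CE (bigID (fun p => p <= s)) /=.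
rewrite expnD -mulnA; apply: leq_mul.
  rewrite -big_filter_cond -big_filter.
  apply: leq_trans (@prod_le_exp _ xpredT _ n.*2 _) _ => [p|].
    rewrite !mem_filter => /and3P[ps pp _] _.
    exact: prime_pow_central_bin.
  rewrite leq_exp2l ?count_predT; last by lia.
  rewrite [X in _ <= X](_ : s = size (index_iota 1 s.+1)); last by rewrite size_iota; lia.
  apply: uniq_leq_size; first by rewrite !filter_uniq // iota_uniq.
  move=> p; rewrite !mem_filter !mem_index_iota.
  by case/andP=> ps /andP[/prime_gt0 p0 _]; lia.
rewrite (bigID (fun p => p <= n)) /= mulnC; apply: leq_mul.
  rewrite -big_filter.
  apply: leq_trans (@prod_le_exp _ xpredT _ n.*2 _) _ => [p|].
    rewrite mem_filter => /andP[/andP[/andP[pp _] _] _] _.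
    exact: prime_pow_central_bin.
  rewrite leq_exp2l ?count_predT; last by lia.
  apply: uniq_leq_size; first by rewrite filter_uniq // iota_uniq.
  move=> p; rewrite !mem_filter !mem_index_iota.
  by case/andP=> /andP[/andP[-> _]]; lia.
apply: leq_trans (primorial_le m).
have -> : \prod_(0 <= p < m.+1 | prime p) p =
          \prod_(0 <= p < n.*2.+1 | prime p && (p <= m)) p.
  rewrite (@big_nat_widen _ _ _ _ _ n.*2.+1) //.
(* Both products now run over the same range, with factor 1 where the condition fails, and are
   compared factor by factor. *)
rewrite [X in X <= _]big_mkcond [X in _ <= X]big_mkcond /=.
apply: leq_prod => p _.
case: (boolP (prime p)) => //= pp; case: (leqP p s) => /= ps.
  by case: ifP => // _; exact: prime_gt0.
have p1 := prime_gt1 pp; have p2 : n.*2 < p ^ 2.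
  by apply: leq_trans sn _; rewrite leq_exp2r.
case: (leqP p n) => pn; last by case: ifP => // _; exact: prime_gt0.
case: (leqP p m) => pm.
  rewrite -[X in _ <= X]expn1 leq_exp2l //.
  have := prime_pow_central_bin n0 pp; rewrite -/C.
  case: (logn p C) => [|[|k]] // H; exfalso.
  have : p ^ 2 <= n.*2 by apply: leq_trans H; rewrite leq_exp2l.
  by rewrite leqNgt p2.
rewrite logn_central_bin0 //.
by rewrite -ltn_divLR.
Qed.

(** * Solutions of p x = p' x' mod q in a box *)

(** [p s = p' h] modulo [q] for some integer [s] with [|s| <= S]; the two
    alternatives are the two signs of [s]. *)
Definition short_rel (q S p p' h : nat) : bool :=
  [exists s : 'I_S.+1, (p * s == p' * h %[mod q]) || (q %| p * s + p' * h)].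

Lemma short_relP (q S p p' h : nat) :
  reflect (exists2 s : int, `|s|%N <= S & (q%:Z %| (p%:Z * s - p'%:Z * h%:Z)%R)%Z)
          (short_rel q S p p' h).
Proof.
apply: (iffP existsP) => [[s /orP[|]]|[s sS]].
- rewrite -eqz_nat -!modz_nat eqz_mod_dvd !PoszM => H.
  by exists (Posz s) => //; rewrite absz_nat -ltnS.
- move=> H; exists (- (s : nat)%:Z)%R; first by rewrite abszN absz_nat -ltnS.
  by rewrite mulrN -opprD rpredN -!PoszM -PoszD.
case: s sS => s sS H.
  have sS' : s < S.+1 by [].
  exists (Ordinal sS') => /=; apply/orP; left.
  by rewrite -eqz_nat -!modz_nat eqz_mod_dvd !PoszM.
have sS' : s.+1 < S.+1 by [].
exists (Ordinal sS') => /=; apply/orP; right.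
by move: H; rewrite NegzE mulrN -opprD rpredN -!PoszM -PoszD.
Qed.

(** Dirichlet's pigeonhole: the residues of [p' j / p] mod [q] for [0 <= j <= H] lie in [H] cells of
    length [S + 1], and two of them in a common cell differ by the required [s]. *)
Lemma short_rel_exists (q S p p' : nat) : 1 < q -> coprime p q ->
  exists2 h, 0 < h <= (q %/ S.+1).+1 & short_rel q S p p' h.
Proof.
move=> q1 cpq; set H := (q %/ S.+1).+1.
have [u pu] : exists u, p * u = 1 %[mod q].
  have p0 : 0 < p by case: p cpq => // /eqP; rewrite gcd0n; lia.
  have [u v E _] := egcdnP q p0.
  by exists u; rewrite mulnC E (eqP cpq) modnMDl.
pose f j := (p' * u * j) %% q.
have fq j : f j < q by rewrite ltn_mod; lia.
have fE j : (q%:Z %| (p%:Z * (f j)%:Z - p'%:Z * j%:Z)%R)%Z.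
  rewrite -!PoszM -eqz_mod_dvd !modz_nat eqz_nat /f modnMmr.
  have -> : p * (p' * u * j) = (p * u) * (p' * j) by lia.
  by rewrite -modnMml pu modnMml mul1n.
have gH (j : 'I_H.+1) : f j %/ S.+1 < H by rewrite ltnS leq_div2r // ltnW.
pose g (j : 'I_H.+1) : 'I_H := Ordinal (gH j).
have : ~~ injectiveb g.
  apply/negP => /injectiveP /leq_card; rewrite !card_ord; lia.
case/injectivePn => j [j' jj' [E]].
wlog lt : j j' jj' E / j < j'.
  move=> W; case: (ltngtP j j') => [lt|lt|/val_inj e].
  - exact: (W j j').
  - by apply: (W j' j) => //; rewrite eq_sym.
  - by rewrite e eqxx in jj'.
exists (j' - j).
  by rewrite subn_gt0 lt (leq_trans (leq_subr _ _)) // -ltnS.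
apply/short_relP; exists ((f j')%:Z - (f j)%:Z)%R.
  have := divn_eq (f j) S.+1; have := divn_eq (f j') S.+1.
  have := ltn_pmod (f j) (ltn0Sn S); have := ltn_pmod (f j') (ltn0Sn S).
  by rewrite E; clear; lia.
rewrite -subzn; last by lia.
have -> : (p%:Z * ((f j')%:Z - (f j)%:Z) - p'%:Z * ((j' : nat)%:Z - (j : nat)%:Z) =
  (p%:Z * (f j')%:Z - p'%:Z * (j' : nat)%:Z) -
  (p%:Z * (f j)%:Z - p'%:Z * (j : nat)%:Z))%R.
  by ring.
by apply: rpredB; exact: fE.
Qed.

Lemma dvdz_eq_of_divn (q m n : nat) :
  (q%:Z %| (m%:Z - n%:Z)%R)%Z -> m %/ q = n %/ q -> m = n.
Proof.
rewrite -eqz_mod_dvd !modz_nat eqz_nat => /eqP E1 E2.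
by rewrite (divn_eq m q) (divn_eq n q) E1 E2.
Qed.

Definition box_sols (q A M p p' : nat) : {set 'I_M * 'I_M} :=
  [set x : 'I_M * 'I_M | p * (A + x.1) == p' * (A + x.2) %[mod q]].

(** Every solution satisfies [h (A + x.1) = s (A + x.2)] mod [q]. Within a block of [x.2] this fixes
    [v] mod [q], so the block and [v %/ q] determine [v]; two distinct solutions sharing both would
    yield a short relation with a smaller index than [h]. The factors of the bound count blocks and
    quotients. *)
Lemma card_box_sols_le (q A M S p p' h : nat) :
  0 < q -> coprime p' q -> 0 < h -> short_rel q S p p' h ->
  (forall k, 0 < k < h -> ~~ short_rel q S p p' k) ->
  #|box_sols q A M p p'| <= (M %/ h).+1 * ((h * (M + S)) %/ q).+1.
Proof.
move=> q0 cp h0 /short_relP [s sS dvs] hmin.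
(* [v x] is [(A + x.1) h - s (A + x.2)] up to a constant depending only on the
   block [x.2 %/ h] of [x.2], chosen so that [v x] is nonnegative. *)
pose w j := if (0 <= s)%R then h.-1 - j %% h else j %% h.
have wh j : w j < h.
  by have := ltn_pmod j h0; rewrite /w; case: ifP => _; lia.
pose v (x : 'I_M * 'I_M) := x.1 * h + `|s|%N * w x.2.
have vB x : v x < h * (M + S).
  rewrite /v; have := ltn_ord x.1; have := wh x.2; nia.
have fB1 (x : 'I_M * 'I_M) : x.2 %/ h < (M %/ h).+1.
  by rewrite ltnS leq_div2r // ltnW.
have fB2 x : v x %/ q < ((h * (M + S)) %/ q).+1.
  by rewrite ltnS leq_div2r // ltnW.
pose f x := (Ordinal (fB1 x), Ordinal (fB2 x)).
rewrite -(card_ord (M %/ h).+1) -(card_ord (_ %/ q).+1) -card_prod.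
apply: (@leq_card_in _ _ f) => x y; rewrite !inE => xB yB [E1 E2].
have lin (z : 'I_M * 'I_M) : p * (A + z.1) == p' * (A + z.2) %[mod q] ->
    (q%:Z %| ((A + z.1)%:Z * h%:Z - s * (A + z.2)%:Z)%R)%Z.
  rewrite -eqz_nat -!modz_nat eqz_mod_dvd !PoszM => zB.
  rewrite -(@Gauss_dvdzr _ (Posz p')) /coprimez; last first.
    by rewrite /gcdz !absz_nat gcdnC (eqP cp).
  have -> : (p'%:Z * ((A + z.1)%:Z * h%:Z - s * (A + z.2)%:Z) =
     s * (p%:Z * (A + z.1)%:Z - p'%:Z * (A + z.2)%:Z) -
     (A + z.1)%:Z * (p%:Z * s - p'%:Z * h%:Z))%R by ring.
  by rewrite rpredB ?dvdz_mull.
have vdiff : ((v x)%:Z - (v y)%:Z =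
   ((x.1 : nat)%:Z - (y.1 : nat)%:Z) * h%:Z - s * ((x.2 : nat)%:Z - (y.2 : nat)%:Z))%R.
  have D1 := divn_eq x.2 h; have D2 := divn_eq y.2 h.
  rewrite E1 in D1; set b := _ %/ h in D1 D2.
  have L1 := ltn_pmod x.2 h0; have L2 := ltn_pmod y.2 h0.
  rewrite {1}D1 {1}D2 /v; set t := `|s|%N.
  rewrite !PoszD !PoszM /w; case: ifP => s0.
    have -> : s = Posz t by rewrite /t gez0_abs.
    have W j : j < h -> Posz (h.-1 - j) = (Posz h - 1 - Posz j)%R.
      by clear -h0; lia.
    by rewrite !W //; ring.
  have -> : s = (- Posz t)%R.
    by rewrite /t ltz0_abs ?opprK // ltNge s0.
  ring.
have vE : v x = v y.
  apply: (@dvdz_eq_of_divn q) => //; rewrite vdiff.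
  have -> : (((x.1 : nat)%:Z - (y.1 : nat)%:Z) * h%:Z -
             s * ((x.2 : nat)%:Z - (y.2 : nat)%:Z) =
    ((A + x.1)%:Z * h%:Z - s * (A + x.2)%:Z) -
    ((A + y.1)%:Z * h%:Z - s * (A + y.2)%:Z))%R.
    by rewrite !PoszD; ring.
  by rewrite rpredB ?lin.
have vd0 : (((x.1 : nat)%:Z - (y.1 : nat)%:Z) * h%:Z =
            s * ((x.2 : nat)%:Z - (y.2 : nat)%:Z))%R.
  by apply/eqP; rewrite -subr_eq0 -vdiff vE subrr.
have dvd : (q%:Z %| (p%:Z * ((x.1 : nat)%:Z - (y.1 : nat)%:Z)
                      - p'%:Z * ((x.2 : nat)%:Z - (y.2 : nat)%:Z))%R)%Z.
  have -> : (p%:Z * ((x.1 : nat)%:Z - (y.1 : nat)%:Z)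
                      - p'%:Z * ((x.2 : nat)%:Z - (y.2 : nat)%:Z) =
    (p%:Z * (A + x.1)%:Z - p'%:Z * (A + x.2)%:Z) -
    (p%:Z * (A + y.1)%:Z - p'%:Z * (A + y.2)%:Z))%R by rewrite !PoszD; ring.
  by rewrite rpredB // -!PoszM -eqz_mod_dvd !modz_nat eqz_nat.
have d2h : `|x.2 - y.2|%N < h.
  have := divn_eq x.2 h; have := divn_eq y.2 h; rewrite E1.
  have := ltn_pmod x.2 h0; have := ltn_pmod y.2 h0.
  by clear; lia.
case: (eqVneq (x.2 : nat) y.2) => [e2|ne2]; last first.
  set d1 := (Posz x.1 - Posz y.1)%R in dvd vd0.
  set d2 := (Posz x.2 - Posz y.2)%R in d2h dvd vd0.
  have d2n0 : 0 < `|d2|%N by rewrite absz_gt0 /d2 subr_eq0 eqz_nat.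
  (* From [|d1| h = |s| |d2|] and [|d2| < h] follows [|d1| <= S], so [|d2|] contradicts the
     minimality of [h]; the sign of [d2] is moved to [d1]. *)
  have /negP[] : ~~ short_rel q S p p' `|d2|%N by rewrite hmin // d2n0.
  apply/short_relP; exists (sgz d2 * d1)%R; last first.
    by rewrite abszEsg mulrCA [X in (_ - X)%R]mulrCA -mulrBr dvdz_mull.
  rewrite abszM -[sgz d2]intz -sgrEz absz_sg -absz_gt0 d2n0 mul1n.
  apply: leq_trans sS; rewrite -(leq_pmul2r h0).
  have := congr1 absz vd0; rewrite !abszM absz_nat => ->.
  by rewrite leq_mul2l (ltnW d2h) orbT.
have e1 : x.1 = y.1 :> nat.
  move: vd0; rewrite e2 subrr mulr0 => /eqP; rewrite mulf_eq0 subr_eq0 !eqz_nat.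
  by rewrite -[h == 0]negbK -lt0n h0 orbF => /eqP.
case: x y e1 e2 {xB yB E1 E2 vdiff vE vd0 dvd d2h} => [x1 x2] [y1 y2] /=.
by move=> /val_inj-> /val_inj->.
Qed.

(** * Residues of the form p x *)

(** In the product bound for the minimal [h], only the term [M %/ h] is not controlled uniformly. It
    is enlarged to a sum over all [h <= H] with a short relation, a form that can be summed over the
    primes. *)
Lemma box_sols_le (q A M S H p p' : nat) :
  1 < q -> coprime p q -> coprime p' q -> H = (q %/ S.+1).+1 ->
  q * #|box_sols q A M p p'| <=
    M * (M + S) + H * (M + S) + q +
    q * \sum_(1 <= h < H.+1) short_rel q S p p' h * (M %/ h).
Proof.
move=> q1 cp cp' HE.
have ex : exists h, (0 < h <= H) && short_rel q S p p' h.
  by have [h hH rh] := short_rel_exists S p' q1 cp; exists h; rewrite HE hH.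
case: (ex_minnP ex) => h /andP[/andP[h0 hH] rh] hmin.
have q0 : 0 < q by lia.
have : #|box_sols q A M p p'| <= (M %/ h).+1 * ((h * (M + S)) %/ q).+1.
  apply: card_box_sols_le rh _ => // k /andP[k0 kh]; apply/negP => rk.
  have : h <= k; last by lia.
  by apply: hmin; rewrite k0 rk andbT (leq_trans (ltnW kh) hH).
have : M %/ h <= \sum_(1 <= h < H.+1) short_rel q S p p' h * (M %/ h).
  have hI : h \in index_iota 1 H.+1 by rewrite mem_index_iota h0 ltnS.
  by rewrite (bigD1_seq h) ?iota_uniq //= rh mul1n leq_addr.
have := leq_divM M h; have := leq_divM (h * (M + S)) q.
set R := #|box_sols q A M p p'|.
set Sg := \sum_(1 <= i < H.+1) short_rel q S p p' i * (M %/ i).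
set a := M %/ h; set b := _ %/ q => hb ha aS RB.
have F1 : q * R <= a.+1 * (h * (M + S) + q).
  apply: (@leq_trans (q * (a.+1 * b.+1))); first by rewrite leq_mul2l RB orbT.
  nia.
apply: leq_trans F1 _.
have F2 : a * h * (M + S) <= M * (M + S) by rewrite leq_mul2r ha orbT.
have F3 : h * (M + S) <= H * (M + S) by rewrite leq_mul2r hH orbT.
have F4 : q * a <= q * Sg by rewrite leq_mul2l aS orbT.
have -> : a.+1 * (h * (M + S) + q) = a * h * (M + S) + h * (M + S) + q + q * a by lia.
by lia.
Qed.

(** A harmonic sum cut at the powers of 2: each dyadic block contributes at most [M]. *)
Lemma sum_div_le (M l : nat) : \sum_(1 <= h < 2 ^ l) M %/ h <= M * l.
Proof.
elim: l => [|l IHl]; first by rewrite big_geq.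
have l2 : 0 < 2 ^ l by rewrite expn_gt0.
rewrite (@big_cat_nat _ _ _ (2 ^ l)) //=; last by rewrite leq_exp2l.
rewrite mulnS addnC; apply: leq_add IHl.
apply: (@leq_trans (\sum_(2 ^ l <= h < 2 ^ l.+1) M %/ 2 ^ l)).
  rewrite big_nat_cond [X in _ <= X]big_nat_cond; apply: leq_sum => h.
  by case/andP=> /andP[lh _] _; apply: leq_div2l.
rewrite sum_nat_const_nat expnS mul2n -addnn addnK.
by rewrite mulnC leq_divM.
Qed.

(** The product [p s] lies in one of two classes mod [q] and is at most [B S], which leaves this
    many values. It determines [p], a prime larger than [S >= s > 0]. *)
Lemma short_rel_count (q S B p' h : nat) (P : seq nat) :
  0 < q -> coprime p' q -> 0 < h < q -> uniq P ->
  (forall p, p \in P -> prime p /\ S < p <= B) ->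
  \sum_(p <- P) short_rel q S p p' h <= 2 * ((B * S) %/ q).+1.
Proof.
move=> q0 cp /andP[h0 hq] uP HP.
rewrite -[X in X <= _]big_mkcond sum1_count -size_filter.
set F := filter _ _.
pose cond p (s : 'I_S.+1) := (p * s == p' * h %[mod q]) || (q %| p * s + p' * h).
(* [f] records the sign and the quotient of [p s] by [q]; the default branch does not arise for [p]
   in [F]. *)
pose f p := if [pick s | cond p s] is Some s
  then (p * s == p' * h %[mod q], (p * s) %/ q) else (true, 0).
pose T := [seq (b, k) | b <- [:: true; false], k <- iota 0 ((B * S) %/ q).+1].
have -> : 2 * ((B * S) %/ q).+1 = size T by rewrite size_allpairs size_iota.
rewrite -(size_map f); apply: uniq_leq_size.
  rewrite map_inj_in_uniq ?filter_uniq // => x y.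
  rewrite !mem_filter => /andP[/existsP[s0 Hs0] xP] /andP[/existsP[t0 Ht0] yP].
  rewrite /f; case: pickP => [s Hs|/(_ s0)]; last by rewrite /cond Hs0.
  case: pickP => [t Ht|/(_ t0)]; last by rewrite /cond Ht0.
  case=> E1 E2.
  (* This excludes [s = 0] below. *)
  have nph : ~~ (q %| p' * h).
    rewrite Gauss_dvdr 1?coprime_sym //; apply/negP => /(dvdn_leq h0).
    by rewrite leqNgt hq.
  have E3 : x * s = y * t %[mod q].
    move: Hs Ht; rewrite /cond; move: E1; case: eqP => [-> | _] /=.
      by move=> /esym/eqP <-.
    move=> /esym/negbT/negPf -> /= Hs Ht.
    by apply/eqP; rewrite -(eqn_modDr (p' * h)) (eqP Hs) (eqP Ht).
  have E4 : x * s = y * t by rewrite (divn_eq (x * s) q) E3 E2 -divn_eq.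
  have s_gt0 : 0 < s.
    rewrite lt0n; apply/eqP => s0E; move: Hs; rewrite /cond s0E muln0 add0n.
    by rewrite (negPf nph) orbF eq_sym mod0n -/(dvdn q _) (negPf nph).
  have [px _] := HP _ xP; have [py /andP[Sy _]] := HP _ yP.
  have : y %| x * s by rewrite E4 dvdn_mulr.
  rewrite Euclid_dvdM // dvdn_prime2 // => /orP[/eqP->//|/(dvdn_leq s_gt0)].
  by move=> ys; have := leq_trans Sy ys; rewrite ltnNge -ltnS ltn_ord.
move=> c /mapP[p]; rewrite mem_filter => /andP[_ pP] ->.
rewrite /f; case: pickP => [s _|_]; apply: allpairs_f.
- by case: (_ == _).
- rewrite mem_iota add0n ltnS leq_div2r // leq_mul //.
    by have [_ /andP[]] := HP _ pP.
  by rewrite -ltnS.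
- by [].
- by rewrite mem_iota.
Qed.

(** * Second moment of the number of representations *)

Definition rep_count (q A M : nat) (P : seq nat) (w : nat) : nat :=
  \sum_(p <- P) \sum_(i < M) (p * (A + i) == w %[mod q]).

Lemma sum_ord_eqmod2 (q a b : nat) : 0 < q ->
  \sum_(w < q) (a == w %[mod q]) * (b == w %[mod q]) = (a == b %[mod q]).
Proof.
move=> q0; rewrite (bigD1 (Ordinal (ltn_pmod a q0))) //= modn_mod eqxx mul1n.
rewrite big1 ?addn0 1?eq_sym // => w.
rewrite -val_eqE /= => wa; rewrite (modn_small (ltn_ord w)) [a %% q == _]eq_sym.
by rewrite (negPf wa).
Qed.

Lemma sum_ord_eqmod (q a : nat) : 0 < q -> \sum_(w < q) (a == w %[mod q]) = 1.
Proof.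
move=> q0; have := sum_ord_eqmod2 a a q0; rewrite eqxx; apply: etrans.
by apply: eq_bigr => w _; case: eqP.
Qed.

Lemma sum_rep_count (q A M : nat) (P : seq nat) : 0 < q ->
  \sum_(w < q) rep_count q A M P w = size P * M.
Proof.
move=> q0; rewrite exchange_big /=.
under eq_bigr => p _ do rewrite exchange_big /=.
under eq_bigr => p _ do under eq_bigr => i _ do rewrite sum_ord_eqmod //.
under eq_bigr => p _ do rewrite sum_nat_const card_ord muln1.
by rewrite big_const_seq count_predT iter_addn_0 mulnC.
Qed.

Lemma sum_rep_count_sqr (q A M : nat) (P : seq nat) : 0 < q ->
  \sum_(w < q) rep_count q A M P w ^ 2 =
  \sum_(p <- P) \sum_(p' <- P) #|box_sols q A M p p'|.
Proof.
move=> q0.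
have E (w : 'I_q) : rep_count q A M P w ^ 2 = \sum_(p <- P) \sum_(p' <- P)
   \sum_(i < M) \sum_(j < M) (p * (A + i) == w %[mod q]) * (p' * (A + j) == w %[mod q]).
  rewrite -mulnn /rep_count big_distrl; apply: eq_bigr => p _ /=.
  rewrite big_distrr; apply: eq_bigr => p' _ /=.
  rewrite big_distrl; apply: eq_bigr => i _ /=.
  by rewrite big_distrr.
rewrite (eq_bigr _ (fun w _ => E w)).
rewrite exchange_big; apply: eq_bigr => p _ /=.
rewrite exchange_big; apply: eq_bigr => p' _ /=.
rewrite exchange_big /=; under eq_bigr => i _ do rewrite exchange_big /=.
under eq_bigr => i _ do under eq_bigr => j _ do rewrite sum_ord_eqmod2 //.
rewrite pair_big -sum1_card [RHS]big_mkcond; apply: eq_bigr => x _ /=.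
by rewrite inE; case: (_ == _).
Qed.

(** Chebyshev's inequality in integers: [(q N(w) - m)^2 >= 0] is summed over [w], where [N] is
    [rep_count] and [m / q] its mean; each [w] with [N(w) = 0] contributes a full [m^2]. *)
Lemma rep_count_variance (q A M : nat) (P : seq nat) : 0 < q ->
  (#|[set w : 'I_q | rep_count q A M P w == 0]| + q) * (size P * M) ^ 2 <=
  q ^ 2 * \sum_(p <- P) \sum_(p' <- P) #|box_sols q A M p p'|.
Proof.
move=> q0; rewrite -sum_rep_count_sqr //; set m := size P * M.
set E := [set w | _].
have : \sum_(w < q) (2 * (q * rep_count q A M P w * m) + (w \in E) * m ^ 2) <=
       \sum_(w < q) ((q * rep_count q A M P w) ^ 2 + m ^ 2).
  apply: leq_sum => w _; rewrite inE; case: eqP => [->|_].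
    by rewrite muln0 /= mul1n leq_addl.
  by rewrite /= mul0n addn0 nat_Cauchy.
rewrite !big_split /= -big_distrr /= -big_distrl /= -big_distrr /= sum_rep_count //.
rewrite -big_distrl /= -big_mkcond sum1_card sum_nat_const card_ord.
under [X in _ <= X + _]eq_bigr => w _ do rewrite expnMn.
rewrite -!big_distrr /= sum_nat_const card_ord -/m -!mulnn; lia.
Qed.

(** When [box_sols_le] is inserted in the variance bound, the main term [K^2 M^2] cancels against
    [q (K M)^2] on the left, and only error terms remain; the one with [l] comes from the short
    relations. *)
Lemma rep_count_zero_le (q A M S H B l K : nat) (P : seq nat) :
  1 < q -> H = (q %/ S.+1).+1 -> H < q -> H < 2 ^ l -> uniq P ->
  (forall p, p \in P -> [/\ prime p, S < p <= B & coprime p q]) ->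
  size P = K ->
  #|[set w : 'I_q | rep_count q A M P w == 0]| * (K * M) ^ 2 <=
  q * (K ^ 2 * (M * S + H * (M + S) + q) + K * M * l * (2 * (B * S + q))).
Proof.
move=> q1 HE Hq Hl uP HP PK; have q0 : 0 < q by apply: ltnW.
have sumP (c : nat) : \sum_(p <- P) c = K * c.
  by rewrite big_const_seq count_predT iter_addn_0 mulnC PK.
have V := @rep_count_variance q A M P q0; rewrite PK in V.
set Z := #|[set w | _]| in V *.
pose c := (2 * ((B * S) %/ q).+1).
(* For fixed [p'] and [h] the sum over [p] is at most [c]; the remaining harmonic sum over [h] is at
   most [M l]. *)
have T : \sum_(p <- P) \sum_(p' <- P) \sum_(1 <= h < H.+1)
     short_rel q S p p' h * (M %/ h) <= K * c * (M * l).
  apply: (@leq_trans (\sum_(1 <= h < H.+1) (K * c) * (M %/ h))); last first.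
    rewrite -big_distrr /= leq_mul2l; apply/orP; right.
    apply: leq_trans (sum_div_le M l).
    by rewrite [X in _ <= X](@big_cat_nat _ _ _ H.+1) //= leq_addr.
  rewrite exchange_big /=.
  under eq_bigr => p' _ do rewrite exchange_big /=.
  rewrite exchange_big /= big_nat_cond [X in _ <= X]big_nat_cond.
  apply: leq_sum => h /andP[/andP[h0 hH] _].
  under eq_bigr => p' _ do rewrite -big_distrl /=.
  rewrite -big_distrl /= leq_mul2r; apply/orP; right.
  rewrite -sumP big_seq [X in _ <= X]big_seq; apply: leq_sum => p' p'P.
  apply: short_rel_count => // [||p pP].
  - by have [] := HP _ p'P.
  - by rewrite h0 (leq_trans hH).
  - by have [-> ->] := HP _ pP.
have R : q * \sum_(p <- P) \sum_(p' <- P) #|box_sols q A M p p'| <=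
   K * (K * (M * (M + S) + H * (M + S) + q)) + q * (K * c * (M * l)).
  apply: (@leq_trans (\sum_(p <- P) \sum_(p' <- P)
     (M * (M + S) + H * (M + S) + q + q * \sum_(1 <= h < H.+1)
     short_rel q S p p' h * (M %/ h)))); last first.
    under eq_bigr => p _ do rewrite big_split sumP -big_distrr /=.
    by rewrite big_split sumP -big_distrr /= leq_add2l leq_mul2l T orbT.
  rewrite big_distrr big_seq [X in _ <= X]big_seq; apply: leq_sum => p pP /=.
  rewrite big_distrr big_seq [X in _ <= X]big_seq; apply: leq_sum => p' p'P /=.
  by apply: box_sols_le => //; [have [] := HP _ pP | have [] := HP _ p'P].
have cq : q * c <= 2 * (B * S + q) by have := leq_divM (B * S) q; rewrite /c; lia.
have F : q * (K * c * (M * l)) <= K * M * l * (2 * (B * S + q)).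
  by apply: leq_trans (leq_mul (leqnn (K * M * l)) cq); lia.
have := leq_mul (leqnn q) (leq_trans R (leq_add (leqnn _) F)).
by clear -V; move: V; rewrite !mulnDl; lia.
Qed.

(** * Pairs of primes and exceptional residues *)

Lemma eqn_mod_mul2l (q w m n : nat) : coprime w q ->
  (w * m == w * n %[mod q]) = (m == n %[mod q]).
Proof.
move=> cw; wlog le : m n / n <= m => [W|].
  have [/W//|/ltnW/W E] := leqP n m.
  by rewrite eq_sym E eq_sym.
rewrite !eqn_mod_dvd ?leq_mul2l ?le ?orbT // -mulnBr Gauss_dvdr //.
by rewrite coprime_sym.
Qed.

Lemma modn_inv_mul (q c n : nat) : 0 < n -> 0 < q -> coprime n q ->
  exists2 w, w < q & w * n = c %[mod q].
Proof.
move=> n0 q0 cn; have [u v E _] := egcdnP q n0.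
exists ((c * u) %% q); first by rewrite ltn_mod.
by rewrite modnMml -mulnA E (eqP cn) mulnDr muln1 mulnA modnMDl.
Qed.

(** A pair is sent to [w = c / (p2 p3)] mod [q] and the quotient of [p2 p3] by [q]. Since [c], hence
    [w], is invertible, these recover [p2 p3], and unique factorization recovers the pair. *)
Lemma card_prime_pairs_le (q c B : nat) (E : {set 'I_q}) (P2 P3 : seq nat) :
  0 < q -> coprime c q -> uniq P2 -> uniq P3 -> ~~ has (mem P2) P3 ->
  (forall p, p \in P2 ++ P3 -> [/\ prime p, p <= B & coprime p q]) ->
  (forall (w : 'I_q) p2 p3, p2 \in P2 -> p3 \in P3 ->
     w * (p2 * p3) = c %[mod q] -> w \in E) ->
  q * (size P2 * size P3) <= #|E| * (B ^ 2 + q).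
Proof.
move=> q0 cc u2 u3 dis HP HE.
have HP2 p : p \in P2 -> [/\ prime p, p <= B & coprime p q].
  by move=> pP; apply: HP; rewrite mem_cat pP.
have HP3 p : p \in P3 -> [/\ prime p, p <= B & coprime p q].
  by move=> pP; apply: HP; rewrite mem_cat pP orbT.
suff : size P2 * size P3 <= #|E| * (B ^ 2 %/ q).+1.
  move=> H; apply: leq_trans (leq_mul (leqnn q) H) _.
  by have := leq_divM (B ^ 2) q; nia.
pose inv (x : nat * nat) := [pick w : 'I_q | w * (x.1 * x.2) == c %[mod q]].
pose f (x : nat * nat) := (inv x, (x.1 * x.2) %/ q).
pose D := [seq (x, y) | x <- P2, y <- P3].
have DP x : x \in D -> x.1 \in P2 /\ x.2 \in P3.
  by case/allpairsP=> y [y1 y2 ->].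
have invP x : x \in D -> exists2 w : 'I_q, inv x = Some w &
    w * (x.1 * x.2) = c %[mod q].
  move=> /DP[x1 x2]; have [px _ cx] := HP2 _ x1; have [py _ cy] := HP3 _ x2.
  have n0 : 0 < x.1 * x.2 by rewrite muln_gt0 !prime_gt0.
  have [w wq wE] := @modn_inv_mul q c (x.1 * x.2) n0 q0 ltac:(by rewrite coprimeMl cx).
  rewrite /inv; case: pickP => [v /eqP vE|/(_ (Ordinal wq))]; first by exists v.
  by rewrite /= wE eqxx.
pose T := [seq (Some w, k) | w <- enum E, k <- iota 0 (B ^ 2 %/ q).+1].
have -> : size P2 * size P3 = size (map f D) by rewrite size_map size_allpairs.
have -> : #|E| * (B ^ 2 %/ q).+1 = size T by rewrite size_allpairs size_iota cardE.
apply: uniq_leq_size.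
  have uD : uniq D by apply: allpairs_uniq => // -[a b] [a' b'].
  rewrite map_inj_in_uniq // => x y xD yD [E1 E2].
  have [w iw wE] := invP _ xD; have [v iv vE] := invP _ yD.
  move: E1; rewrite iw iv => -[wv]; rewrite -{v}wv in iv vE.
  have cw : coprime w q.
    have : coprime (w * (x.1 * x.2)) q by rewrite -coprime_modl wE coprime_modl.
    by rewrite coprimeMl => /andP[].
  have E3 : x.1 * x.2 == y.1 * y.2 %[mod q].
    by rewrite -(eqn_mod_mul2l _ _ cw) wE vE.
  have E4 : x.1 * x.2 = y.1 * y.2.
    by rewrite (divn_eq (x.1 * x.2) q) E2 (eqP E3) -divn_eq.
  have [x1 x2] := DP _ xD; have [y1 y2] := DP _ yD.
  have [p1 _ _] := HP2 _ x1; have [p2 _ _] := HP3 _ x2.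
  have [p1' _ _] := HP2 _ y1; have [p2' _ _] := HP3 _ y2.
  have E5 : x.1 = y.1.
    have : x.1 %| y.1 * y.2 by rewrite -E4 dvdn_mulr.
    rewrite Euclid_dvdM // !dvdn_prime2 // => /orP[/eqP //|/eqP e].
    (* The swapped factorization would put one prime in both lists. *)
    by case/hasP: dis; exists y.2 => //=; rewrite -e.
  move: E4; rewrite E5 => /eqP; rewrite eqn_pmul2l ?prime_gt0 // => /eqP.
  by move: E5; case: x y {xD yD E2 iw wE iv vE E3 x1 x2 y1 y2 p1 p2 p1' p2'}
     => ? ? [? ?] /= -> ->.
move=> z /mapP[x xD ->]; have [w iw wE] := invP _ xD.
have [x1 x2] := DP _ xD; rewrite /f iw; apply: allpairs_f.
  by rewrite mem_enum; exact: HE wE.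
rewrite mem_iota add0n ltnS leq_div2r // -mulnn leq_mul //.
  by have [] := HP2 _ x1.
by have [] := HP3 _ x2.
Qed.

(** If all residues [c / (p2 p3)] lacked a representation, [card_prime_pairs_le] would give
    [q K^2 <= #|E| (B^2 + q)], against [rep_count_zero_le] and the final inequality assumed. *)
Lemma exists_prime_product (q c A M S H B l K : nat) (P1 P2 P3 : seq nat) :
  1 < q -> coprime c q -> H = (q %/ S.+1).+1 -> H < q -> H < 2 ^ l ->
  uniq (P1 ++ P2 ++ P3) ->
  (forall p, p \in P1 ++ P2 ++ P3 -> [/\ prime p, S < p <= B & coprime p q]) ->
  size P1 = K -> size P2 = K -> size P3 = K ->
  (B ^ 2 + q) * (K ^ 2 * (M * S + H * (M + S) + q) +
                 K * M * l * (2 * (B * S + q))) < K ^ 2 * (K * M) ^ 2 ->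
  exists p1 p2 p3 x, [/\ p1 \in P1, p2 \in P2, p3 \in P3, A <= x < A + M &
    p1 * p2 * p3 * x = c %[mod q]].
Proof.
move=> q1 cc HE Hq Hl; rewrite !cat_uniq => /and3P[u1 _ /and3P[u2 d23 u3]] HP.
move=> s1 s2 s3 ineq; have q0 : 0 < q by apply: ltnW.
have Z := @rep_count_zero_le q A M S H B l K P1 q1 HE Hq Hl u1 _ s1.
set E := [set w : 'I_q | _] in Z.
have {}Z : #|E| * (K * M) ^ 2 <= q * (K ^ 2 * (M * S + H * (M + S) + q)
    + K * M * l * (2 * (B * S + q))).
  by apply: Z => p pP; apply: HP; rewrite mem_cat pP.
have HP' p : p \in P2 ++ P3 -> [/\ prime p, p <= B & coprime p q].
  by move=> pP; have [|? /andP[]] := HP p _; first by rewrite mem_cat pP orbT.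
case: (boolP [exists w : 'I_q, (w \notin E) && has (fun p2 => has (fun p3 =>
   w * (p2 * p3) == c %[mod q]) P3) P2]) => [/existsP[w /andP[wE]]|].
  case/hasP=> p2 p2P /hasP[p3 p3P /eqP wc].
  move: wE; rewrite inE /rep_count -lt0n.
  rewrite lt0n sum_nat_seq_neq0 => /hasP[p1 p1P /=].
  rewrite sum_nat_seq_neq0 => /hasP[i _ /=]; rewrite eqb0 negbK => /eqP E1.
  exists p1, p2, p3, (A + i); split => //; first by rewrite leq_addr ltn_add2l ltn_ord.
  have -> : p1 * p2 * p3 * (A + i) = (p1 * (A + i)) * (p2 * p3).
    by clear; lia.
  by rewrite -modnMml E1 modnMml.
rewrite negb_exists => /forallP HN; exfalso.
have : q * (size P2 * size P3) <= #|E| * (B ^ 2 + q).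
  apply: (@card_prime_pairs_le q c B E P2 P3) => // w p2 p3 p2P p3P wc.
  move: (HN w); rewrite negb_and negbK => /orP[//|/hasP[]].
  by exists p2 => //; apply/hasP; exists p3 => //; apply/eqP.
rewrite s2 s3 => C1; move: ineq; apply/negP; rewrite -leqNgt -(leq_pmul2l q0).
set Z1 := (_ + _) in Z *; set Z2 := (K * M) ^ 2 in Z *.
have := leq_mul C1 (leqnn Z2); have := leq_mul Z (leqnn (B ^ 2 + q)).
by rewrite -/Z1 -(mulnn K); clear; lia.
Qed.

(** * Choice of the parameters *)

(** With [T = L ^ 8], both error sums [X1] and [X2] are [O(Y^2 / T)], while [K] and [M] are at least
    [Y] over a multiple of [L]. The comparison loses at most [L ^ 5] up to constants, which [T]
    outweighs. *)
Lemma param_ineq (q Y L K M S H : nat) :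
  110 <= L -> 0 < q -> q * L ^ 16 <= Y ^ 2 -> Y <= 9 * L * K -> Y <= 24 * L * M ->
  M <= Y -> S = Y %/ L ^ 8 -> H = (q %/ S.+1).+1 ->
  ((2 * Y) ^ 2 + q) * (K ^ 2 * (M * S + H * (M + S) + q) +
                 K * M * L * (2 * (2 * Y * S + q))) < K ^ 2 * (K * M) ^ 2.
Proof.
move=> L110 q0 qY YK YM MY SE HE.
(* An opaque constant, so that [c * c * c] is never evaluated in unary. *)
have [c cE] : exists c, c = 110 by exists 110.
rewrite -cE in L110.
have L3 : c * c * c <= L * L * L by rewrite !leq_mul.
set T := L ^ 8; have L0 : 0 < L by apply: leq_trans L110; rewrite cE.
have T0 : 0 < T by rewrite expn_gt0 L0.
have TE : T = L * L * L * (L * L * L) * (L * L) by rewrite /T !expnS; clear; lia.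
have ST : S * T <= Y by rewrite SE leq_divM.
have YST : Y < S.+1 * T by rewrite SE -ltn_divLR.
have HS : H * S.+1 <= q + S.+1 by rewrite HE mulSn addnC leq_add2r leq_divM.
have qTY : q * (T * T) <= Y * Y by move: qY; rewrite -[16]/(8 + 8) expnD mulnn.
have TY : T <= Y.
  rewrite -leq_sqr -!mulnn; apply: leq_trans qTY; exact: leq_pmull.
have SY : S <= Y by rewrite SE leq_div.
have qY1 : q * T <= Y * Y by apply: leq_trans qTY; rewrite leq_mul2l leq_pmull ?orbT.
have qY2 : q <= Y * Y by apply: leq_trans qY1; exact: leq_pmulr.
have HY : H * Y <= (q + S.+1) * T.
  apply: (@leq_trans (H * (S.+1 * T))); first by rewrite leq_mul2l ltnW ?orbT.
  by rewrite mulnA leq_mul2r HS orbT.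
set X1 := M * S + _ + q; set X2 := 2 * (_ + q).
have X1T : X1 * T <= 8 * (Y * Y).
  have a1 : M * (S * T) <= Y * Y by exact: leq_mul.
  have a2 : H * (M + S) * T <= 2 * (H * Y) * T.
    by rewrite leq_mul2r; apply/orP; right; rewrite mulnCA leq_mul2l; clear -MY SY; lia.
  have a3 : H * Y * T <= (q + S.+1) * T * T by rewrite leq_mul2r HY orbT.
  have a4 : S * T * T <= Y * Y by exact: leq_mul.
  have a5 : T * T <= Y * Y by exact: leq_mul.
  rewrite /X1; clear -a1 a2 a3 a4 a5 qTY qY1; lia.
have X2T : X2 * T <= 6 * (Y * Y).
  have a1 : Y * (S * T) <= Y * Y by rewrite leq_mul2l ST orbT.
  rewrite /X2; clear -a1 qY1; lia.
have Y0 : 0 < Y by apply: leq_trans TY.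
have K0 : 0 < K by by case: K YK => //; rewrite muln0 leqNgt Y0.
have M0 : 0 < M by by case: M YM {MY X1 X1T} => //; rewrite muln0 leqNgt Y0.
clearbody T X1 X2.
(* The constants are [216 = 9 * 24] and, below, [81 = 9 * 9]. *)
have YY : Y * Y <= 216 * (L * L) * (K * M).
  by apply: leq_trans (leq_mul YK YM) _; clear; lia.
have Y4 : Y * Y * (Y * Y) <= 216 * 216 * (L * L * (L * L)) * (K * M * (K * M)).
  by apply: leq_trans (leq_mul YY YY) _; clear; lia.
have Y4' : Y * Y * (Y * Y) <= 216 * 81 * (L * L * (L * L)) * (K * K * K * M).
  by apply: leq_trans (leq_mul YY (leq_mul YK YK)) _; clear; lia.
have C1 : 80 * (216 * 216) * (L * L * (L * L)) <= T.
  have b1 : 80 * (216 * 216) <= L * L * L * L.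
    apply: leq_trans (leq_mul L3 L110); rewrite cE; clear; lia.
  rewrite TE; apply: leq_trans (leq_mul b1 (leqnn _)) _; clear; lia.
(* The tightest use of the bound 110: [60 * 216 * 81 = 1049760] is below [110^3 = 1331000]. *)
have C2 : 60 * (216 * 81) * (L * (L * L * (L * L))) < T.
  have b1 : 60 * (216 * 81) < L * L * L by apply: leq_trans L3; rewrite cE; clear; lia.
  have b2 : 0 < L * (L * L * (L * L)) by rewrite !muln_gt0 L0.
  rewrite -(ltn_pmul2r b2) in b1; apply: leq_trans b1 _; rewrite TE; clear; lia.
(* The 10 is twice the 5 of [Q5]: [I1] and [I2] each account for half of the right-hand side. *)
have I1 : 10 * (Y * Y) * X1 <= K * M * (K * M).
  rewrite -(leq_pmul2r T0); apply: (@leq_trans (80 * (Y * Y * (Y * Y)))).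
    by have := leq_mul X1T (leqnn (Y * Y)); clear; lia.
  apply: leq_trans (leq_mul (leqnn 80) Y4) _.
  by have := leq_mul C1 (leqnn (K * M * (K * M))); clear; lia.
have I2 : 10 * (Y * Y) * L * X2 < K * K * K * M.
  rewrite -(ltn_pmul2r T0); apply: (@leq_ltn_trans (60 * L * (Y * Y * (Y * Y)))).
    by have := leq_mul X2T (leqnn (L * (Y * Y))); clear; lia.
  apply: leq_ltn_trans (leq_mul (leqnn (60 * L)) Y4') _.
  have W : 0 < K * K * K * M by rewrite !muln_gt0 K0 M0.
  by move: C2; rewrite -(ltn_pmul2r W); clear; lia.
have Q5 : (2 * Y) ^ 2 + q <= 5 * (Y * Y) by rewrite -mulnn; clear -qY2; lia.
apply: leq_ltn_trans (leq_mul Q5 (leqnn _)) _.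
rewrite -!(mulnn K) -(mulnn (K * M)).
have J1 : K * K * (10 * (Y * Y) * X1) <= K * K * (K * M * (K * M)).
  by rewrite leq_mul2l I1 orbT.
have KM0 : 0 < K * M by rewrite muln_gt0 K0.
move: I2; rewrite -(ltn_pmul2l KM0) => J2.
clear -J1 J2; lia.
Qed.

Lemma mem_primes_in (m n p : nat) : (p \in primes_in m n) = prime p && (m < p <= n).
Proof. by rewrite mem_filter mem_index_iota ltnS. Qed.

Lemma uniq_primes_in (m n : nat) : uniq (primes_in m n).
Proof. by rewrite filter_uniq ?iota_uniq. Qed.

(** Two such primes would have a product dividing [q] and exceeding [Y^2 >= q]. *)
Lemma count_large_prime_divisors (q Y : nat) (P : seq nat) :
  0 < q -> q <= Y ^ 2 -> uniq P -> (forall p, p \in P -> prime p /\ Y < p) ->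
  count (fun p => ~~ coprime p q) P <= 1.
Proof.
move=> q0 qY uP HP; rewrite -size_filter.
have := filter_uniq (fun p => ~~ coprime p q) uP.
have : forall p, p \in [seq p <- P | ~~ coprime p q] -> [/\ prime p, Y < p & p %| q].
  move=> p; rewrite mem_filter => /andP[cp /HP[pp Yp]]; split=> //.
  by move: cp; rewrite prime_coprime // negbK.
case: filter => [|a [|b F]] // H; rewrite /= inE negb_or -!andbA => /andP[ab _].
have [pa Ya aq] := H a (mem_head _ _).
have [pb Yb bq] : [/\ prime b, Y < b & b %| q] by apply: H; rewrite !inE eqxx orbT.
have : a * b %| q by rewrite Gauss_dvd ?aq // prime_coprime // dvdn_prime2.
move/(dvdn_leq q0); rewrite leqNgt => /negP[].
by apply: leq_ltn_trans qY _; rewrite -mulnn ltn_mul.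
Qed.

(** Logarithms to base 2 in [chebyshev] with [s = Y %/ (12 L)] give [2Y <= L + L (s + N) + 2m] with
    [3m <= 2Y]. Hence [8Y <= 12 L + 12 L s + 12 L N], and [12 L s <= Y]. *)
Lemma size_primes_in_ge (Y L : nat) : 110 <= L -> L ^ 8 <= Y -> Y.*2 < 2 ^ L ->
  7 * Y <= 12 * L + 12 * L * size (primes_in Y Y.*2).
Proof.
move=> L110 LY YL.
have L0 : 0 < L by apply: leq_trans L110.
(* Since [288 = 2 * 12^2], this gives [(Y / 12L)^2 >= 2Y], the condition of [chebyshev] on [s]. *)
have LLY : 288 * (L * L) <= Y.
  apply: leq_trans LY; have -> : L ^ 8 = L ^ 6 * (L * L) by rewrite !expnS; clear; lia.
  rewrite leq_mul2r; apply/orP; right.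
  apply: (@leq_trans (110 * 110)); first by clear; lia.
  by apply: leq_trans (leq_mul L110 L110) _; rewrite -[L * L]/(L ^ 2) leq_pexp2l.
have Y0 : 0 < Y by apply: leq_trans LLY; rewrite !muln_gt0 L0.
pose s := Y %/ (12 * L); set N := size _.
have L12 : 0 < 12 * L by rewrite muln_gt0.
have sL : s * (12 * L) <= Y by exact: leq_divM.
have sY : Y < s.+1 * (12 * L) by rewrite -ltn_divLR.
have s2 : Y.*2 < s.+1 ^ 2.
  have W : 0 < 144 * (L * L) by rewrite !muln_gt0 L0.
  rewrite -(ltn_pmul2r W); apply: (@leq_ltn_trans (Y * Y)).
    by have := leq_mul LLY (leqnn Y); clear; lia.
  by have := ltn_mul sY sY; rewrite -(mulnn s.+1); clear; lia.
have := chebyshev Y0 s2; rewrite -/N.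
set m := _ %/ 3 => H.
have m3 : m * 3 <= Y.*2 by exact: leq_divM.
have : 2 ^ (2 * Y) <= 2 ^ (L + (L * (s + N) + 2 * m)).
  rewrite [2 ^ (2 * Y)]expnM; apply: leq_trans H _.
  have -> : 2 ^ (L + (L * (s + N) + 2 * m)) = 2 ^ L * ((2 ^ L) ^ (s + N) * 4 ^ m).
    by rewrite -[4]/(2 ^ 2) -!expnM -!expnD.
  apply: leq_mul; first exact: YL.
  apply: leq_mul => //; case: (s + N) => // e.
  by rewrite leq_exp2r // ltnW.
rewrite leq_exp2l // => E.
have := leq_mul (leqnn 3) E; clear -sL m3; lia.
Qed.

(** [x] ranges over [(Y, Y + M]] and the primes are taken in [(Y + M, 2Y]], so that [x] is below
    each of them. Three disjoint lists of [K] primes are cut from [G]. *)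
Lemma exists_prime_product_mod (q Y L c : nat) :
  110 <= L -> 2 < q -> q * L ^ 16 <= Y ^ 2 -> q < 2 ^ L -> Y.*2 < 2 ^ L ->
  coprime c q ->
  exists p1 p2 p3 x,
    [/\ prime p1, prime p2, prime p3, uniq [:: p1; p2; p3] &
    [/\ all (fun p => x < p <= Y.*2) [:: p1; p2; p3], Y < x,
        p1 * p2 * p3 * x = c %[mod q] & Y.+1 ^ 4 <= p1 * p2 * p3 * x]].
Proof.
move=> L110 q2 qY qL YL cc.
have q0 : 0 < q by apply: leq_trans q2.
have L0 : 0 < L by apply: leq_trans L110.
have T0 : 0 < L ^ 8 by rewrite expn_gt0 L0.
have LY : L ^ 8 <= Y.
  rewrite -leq_sqr -expnM; apply: leq_trans qY; exact: leq_pmull.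
have N7 := size_primes_in_ge L110 LY YL.
pose M := Y %/ (12 * L).
have L12 : 0 < 12 * L by rewrite muln_gt0.
have ML : M * (12 * L) <= Y by exact: leq_divM.
have YM : Y < M.+1 * (12 * L) by rewrite -ltn_divLR.
have L24 : 24 * L <= Y.
  apply: leq_trans LY; rewrite [L ^ 8]expnSr leq_mul2r; apply/orP; right.
  apply: (@leq_trans L); first exact: leq_trans L110.
  by rewrite -{1}[L]expn1 leq_exp2l //; apply: leq_trans L110.
have M0 : 0 < M by rewrite divn_gt0 //; apply: leq_trans L24; rewrite leq_mul2r orbT.
have MY : M <= Y by exact: leq_div.
pose G := [seq p <- primes_in (Y + M) Y.*2 | coprime p q].
have HG p : p \in G -> [/\ prime p, Y + M < p <= Y.*2 & coprime p q].
  by rewrite mem_filter mem_primes_in => /and3P[].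
have uG : uniq G by rewrite filter_uniq ?uniq_primes_in.
(* The loss is at most the [M] integers in [(Y, Y + M]] and one prime divisor of [q]. *)
have sG : size (primes_in Y Y.*2) <= M + (size G).+1.
  apply: (@leq_trans (M + size (primes_in (Y + M) Y.*2))).
    rewrite -[X in X + _](size_iota Y.+1) -size_cat.
    apply: uniq_leq_size; first exact: uniq_primes_in.
    move=> p; rewrite mem_primes_in mem_cat mem_iota mem_primes_in.
    by case/and3P=> -> Yp ->; rewrite Yp andbT /= addSn ltnS; case: leqP.
  rewrite leq_add2l -(count_predC (fun p => coprime p q)) -size_filter -addn1 leq_add2l.
  apply: (@count_large_prime_divisors q Y) => //; last first.
  - move=> p; rewrite mem_primes_in => /and3P[-> Yp _]; split=> //.
    by apply: leq_ltn_trans Yp; exact: leq_addr.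
  - exact: uniq_primes_in.
  by apply: leq_trans qY; rewrite leq_pmulr // expn_gt0 L0.
pose K := size G %/ 3.
have KG : K * 3 <= size G by exact: leq_divM.
have GK : size G < K.+1 * 3 by rewrite -ltn_divLR.
(* The bounds combine to [6Y <= 36 L K + 48 L], and [48 L <= 2Y]. *)
have YK : Y <= 9 * L * K.
  have a1 := leq_mul (leqnn (12 * L)) sG.
  have a2 := leq_mul (leqnn (12 * L)) GK.
  clear -N7 a1 a2 ML L24; lia.
have YM' : Y <= 24 * L * M.
  have a1 := leq_mul M0 (leqnn (12 * L)).
  clear -YM a1; lia.
pose S := Y %/ L ^ 8; pose H := (q %/ S.+1).+1.
have S0 : 0 < S by rewrite divn_gt0.
have Hq : H < q.
  have : q %/ S.+1 <= q %/ 2 by apply: leq_div2l.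
  have := leq_divM q 2; rewrite /H; clear -q2; lia.
have PE : take K G ++ take K (drop K G) ++ take K (drop (K + K) G) =
    take (K + (K + K)) G by rewrite [in RHS]takeD [in RHS]takeD drop_drop.
have subG p : p \in take K G ++ take K (drop K G) ++ take K (drop (K + K) G) -> p \in G.
  by rewrite PE; exact: mem_take.
have ineq := param_ineq L110 q0 qY YK YM' MY (erefl S) (erefl H).
have sK n : n <= K + K -> size (take K (drop n G)) = K.
  by move=> nK; rewrite size_takel // size_drop; clear -nK KG; lia.
have [|||||] := @exists_prime_product q c Y.+1 M S H (2 * Y) L K (take K G)
    (take K (drop K G)) (take K (drop (K + K) G)) (ltnW q2) cc erefl Hq
    (ltn_trans Hq qL) _ _ _ _ _ ineq.
- by rewrite PE take_uniq.
- move=> p /subG/HG[pp /andP[pY p2] cp]; split=> //.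
  rewrite mul2n p2 andbT; apply: leq_ltn_trans pY.
  by apply: leq_trans (leq_div _ _) _; exact: leq_addr.
- by rewrite -{1}[G]drop0 sK.
- by rewrite sK // leq_addr.
- by rewrite sK.
move=> p1 [p2 [p3 [x [p1P p2P p3P /andP[Yx xM] E]]]].
have xG p : p \in G -> x < p <= Y.*2.
  case/HG=> _ /andP[pM ->] _; rewrite andbT; apply: leq_ltn_trans pM.
  by rewrite -ltnS -addSn.
have g1 : p1 \in G by apply: subG; rewrite mem_cat p1P.
have g2 : p2 \in G by apply: subG; rewrite !mem_cat p2P orbT.
have g3 : p3 \in G by apply: subG; rewrite !mem_cat p3P !orbT.
exists p1, p2, p3, x; split.
- by have [] := HG _ g1.
- by have [] := HG _ g2.
- by have [] := HG _ g3.
- have : uniq (take K G ++ take K (drop K G) ++ take K (drop (K + K) G)).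
    by rewrite PE take_uniq.
  rewrite !cat_uniq => /and3P[_ /hasPn d1 /and3P[_ /hasPn d2 _]].
  rewrite /= !inE andbT negb_or -!andbA; apply/and3P; split; apply/eqP => e.
  + by have /negP[] := d1 p2 (ltac:(by rewrite mem_cat p2P)); rewrite -e.
  + by have /negP[] := d1 p3 (ltac:(by rewrite mem_cat p3P orbT)); rewrite -e.
  + by have /negP[] := d2 p3 p3P; rewrite -e.
split=> //; first by rewrite /= !xG.
have gt p : p \in G -> Y < p by move/xG/andP=> [xp _]; exact: ltn_trans Yx xp.
by rewrite !expnSr expn0 mul1n !leq_mul // gt.
Qed.

(** * Approximation *)

Local Open Scope ring_scope.

Lemma bernoulli_le (R : realDomainType) (x : R) (n : nat) :
  0 <= x -> 1 + x *+ n <= (1 + x) ^+ n.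
Proof.
move=> x0; elim: n => [|n IHn]; first by rewrite mulr0n addr0 expr0.
have h : 0 <= x *+ n by rewrite mulrn_wge0.
rewrite exprS; apply: le_trans (ler_wpM2l _ IHn); last by rewrite addr_ge0.
by rewrite mulrS mulrDl mul1r mulrDr mulr1; have := mulr_ge0 x0 h; lra.
Qed.

(** With [d = e / (n + 1)], Bernoulli's inequality for [(2^d)^t <= q^d] bounds [t + 1] by [y q^d].
    The [n]-th power uses [n] of the [n + 1] factors [q^d] in [q^e]; the last absorbs [C y^n] for
    large [q]. *)
Lemma trunc_log_pow_le_powR (R : realType) (e C : R) (n : nat) : 0 < e -> 0 <= C ->
  exists q0 : R, forall q : nat, (0 < q)%N -> q0 <= q%:R ->
    C * (trunc_log 2 q).+1%:R ^+ n <= q%:R `^ e.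
Proof.
move=> e0 C0; pose d := e / n.+1%:R.
have d0 : 0 < d by rewrite divr_gt0.
pose x : R := 2 `^ d - 1.
have x0 : 0 < x.
  have := @gt0_ltr_powR R d d0 1 2; rewrite /= powR1 !nnegrE ler0n ler01 ltr1n.
  by move=> /(_ isT isT isT); rewrite subr_gt0.
pose y := 1 + x^-1.
have y1 : 1 <= y by rewrite lerDl invr_ge0 ltW.
have yx : 1 <= y * x by rewrite mulrDl mulVf ?gt_eqF // mul1r lerDr ltW.
have y0 : 0 <= y by lra.
exists ((C * y ^+ n) `^ d^-1) => q q_gt0 hq.
set t := trunc_log 2 q.
have q0 : (0 : R) <= q%:R by [].
have qd0 : 0 <= q%:R `^ d :> R by exact: powR_ge0.
have tq : t.+1%:R <= y * q%:R `^ d.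
  have : (2 `^ d) ^+ t <= q%:R `^ d :> R.
    have H2 : 2 ^+ t <= q%:R :> R.
      have : ((2 ^ t)%N%:R : R) <= q%:R by rewrite ler_nat trunc_logP.
      by rewrite natrX.
    have -> : (2 `^ d) ^+ t = (2 ^+ t) `^ d :> R.
      rewrite -(powR_mulrn t (powR_ge0 2 d)) -powRrM mulrC powRrM.
      by rewrite (powR_mulrn t (ler0n R 2)).
    by apply: (ge0_ler_powR (ltW d0)) H2; rewrite nnegrE ?exprn_ge0.
  have -> : (2 `^ d : R) = 1 + x by rewrite /x; lra.
  move/(le_trans (bernoulli_le t (ltW x0))) => H.
  have := ler_wpM2l y0 H; apply: le_trans.
  by rewrite mulrDr mulr1 mulrnAr -natr1 addrC lerD // lerMn2r yx orbT.
have Cq : C * y ^+ n <= q%:R `^ d.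
  have Cy : 0 <= C * y ^+ n by rewrite mulr_ge0 ?exprn_ge0.
  have := @ge0_ler_powR R d (ltW d0) _ _ _ _ hq.
  rewrite /= -powRrM mulVf ?gt_eqF // powRr1 // !nnegrE powR_ge0 q0; exact.
have -> : q%:R `^ e = q%:R `^ d ^+ n * q%:R `^ d :> R.
  rewrite -exprSr -powR_mulrn // -powRrM; congr (_ `^ _).
  by rewrite /d divfK // pnatr_eq0.
apply: (@le_trans _ _ (C * (y * q%:R `^ d) ^+ n)).
  by apply: ler_wpM2l => //; apply: lerXn2r => //; rewrite nnegrE ?mulr_ge0.
rewrite exprMn mulrA mulrC; apply: ler_wpM2l => //; exact: exprn_ge0.
Qed.

Lemma exists_invz_mod (a : int) (n : nat) : (0 < n)%N -> gcdz a n = 1 ->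
  exists2 c : nat, coprime c n & (n %| a * c%:Z - 1)%Z.
Proof.
move=> n0 /eqP/coprimezP[[u v] /= E].
have n0' : n%:Z != 0 by rewrite eqz_nat -lt0n.
have [c cE] : exists c : nat, (u %% n)%Z = c.
  by exists `|(u %% n)%Z|%N; rewrite gez0_abs // modz_ge0.
have dvd : (n %| a * c%:Z - 1)%Z.
  rewrite -cE -E; have -> : a * (u %% n)%Z - (u * a + v * n) = (- a * (u %/ n)%Z - v) * n.
    by rewrite {2}(divz_eq u n); ring.
  exact: dvdz_mull.
exists c => //.
have : coprimez c n.
  apply/coprimezP; case/dvdzP: dvd => k kE; exists (a, - k) => /=.
  by rewrite mulNr -kE; ring.
by rewrite /coprimez /gcdz !absz_nat.
Qed.

(** Divided by [u v], this splits [m / (u v)] as [r / u + s / v]. *)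
Lemma partial_fractions (m : int) (u v : nat) : coprime u v ->
  exists r s : int, m = r * v%:Z + s * u%:Z.
Proof.
move=> cuv; have : coprimez u v by rewrite /coprimez /gcdz !absz_nat.
case/coprimezP=> -[x y] /= E; exists (m * y), (m * x).
by rewrite -!mulrA -mulrDr [_ + _]addrC E mulr1.
Qed.

(** The nested numerator is what three successive uses of [partial_fractions] produce. *)
Lemma four_fractionsE (F : fieldType) (a q p1 p2 p3 x r1 r2 r3 r4 : F) :
  q != 0 -> p1 != 0 -> p2 != 0 -> p3 != 0 -> x != 0 ->
  a * (p1 * p2 * p3 * x) - 1 =
    (r1 * (p2 * p3 * x) + (r2 * (p3 * x) + (r3 * x + r4 * p3) * p2) * p1) * q ->
  a / q - r1 / p1 - r2 / p2 - r3 / p3 - r4 / x = (q * (p1 * p2 * p3 * x))^-1.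
Proof.
move=> q0 p10 p20 p30 x0; set D := p1 * _ * _ * x; set m := (_ + _) * q => E.
have D0 : D != 0 by rewrite !mulf_neq0.
have -> : a = (1 + m) / D by rewrite -E addrC subrK mulfK.
by rewrite /m /D; field; rewrite q0 p10 p20 p30 x0.
Qed.

(** With [D = p1 p2 p3 x], the relation [a D - 1 = m q] reads [a/q - m/D = 1/(q D)], and coprimality
    splits [m/D]. *)
Lemma approx_of_product (R : realType) (q p1 p2 p3 x : nat) (a m : int) :
  [/\ (0 < q)%N, (0 < p1)%N, (0 < p2)%N, (0 < p3)%N & (0 < x)%N] ->
  coprime p1 (p2 * p3 * x) -> coprime p2 (p3 * x) -> coprime p3 x ->
  a * (p1 * p2 * p3 * x)%N%:Z - 1 = m * q%:Z ->
  exists a1 a2 a3 a4 : int,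
    a%:~R / q%:R - a1%:~R / p1%:R - a2%:~R / p2%:R - a3%:~R / p3%:R - a4%:~R / x%:R
    = (q%:R * (p1 * p2 * p3 * x)%N%:R)^-1 :> R.
Proof.
move=> [q0 p10 p20 p30 x0] c1 c2 c3 E.
have [r1 [m1 E1]] := partial_fractions m c1.
have [r2 [m2 E2]] := partial_fractions m1 c2.
have [r3 [r4 E3]] := partial_fractions m2 c3.
exists r1, r2, r3, r4; rewrite !natrM.
apply: four_fractionsE; rewrite ?pnatr_eq0 -?lt0n //.
have := congr1 (fun z : int => z%:~R : R) E.
rewrite E1 E2 E3 rmorphB !rmorphM !rmorphD !rmorphM /= !rmorphD !rmorphM /=.
by rewrite rmorphD !rmorphM.
Qed.

Unset Implicit Arguments.

Theorem theorem2 (R : realType) (eps : R) (heps : 0 < eps) :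
  exists q0 : R,
    forall (q a Q : int),
      q0 <= q%:~R ->
      gcdz a q = 1 ->
      q%:~R `^ (2 + eps) <= Q%:~R ->
      exists (a1 a2 a3 a4 : int) (q1 q2 q3 q4 : int),
        ((1 <= q1) /\ (q1%:~R <= 2 * Q%:~R `^ (1 / 4) :> R)) /\
        ((1 <= q2) /\ (q2%:~R <= 2 * Q%:~R `^ (1 / 4) :> R)) /\
        ((1 <= q3) /\ (q3%:~R <= 2 * Q%:~R `^ (1 / 4) :> R)) /\
        ((1 <= q4) /\ (q4%:~R <= 2 * Q%:~R `^ (1 / 4) :> R)) /\
        `| a%:~R / q%:~R - a1%:~R / q1%:~R - a2%:~R / q2%:~R
             - a3%:~R / q3%:~R - a4%:~R / q4%:~R |
          <= 1 / (q%:~R * Q%:~R) :> R.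
Proof.
have eps2 : 0 < eps / 2 by rewrite divr_gt0.
(* The exponent 16 is that of [L] in [exists_prime_product_mod]; the factor 4 pays for
   [X^2 <= 4 Y^2]. *)
have [q1 Hq1] := trunc_log_pow_le_powR 16 eps2 (ler0n R 4).
(* An opaque exponent, so that [2 ^ k] is never evaluated in unary. *)
have [k kE] : exists k, k = 110%N by exists 110%N.
exists (Num.max q1 (2 ^+ k)) => -[q|q] a Q; last first.
  (* A negative [q] is below the positive bound [2 ^+ k]. *)
  rewrite NegzE => h; exfalso; move: h; rewrite ge_max => /andP[_].
  rewrite mulrNz leNgt => /negP[].
  by apply: (@le_lt_trans _ _ 0); rewrite ?oppr_le0 ?ler0z // exprn_gt0.
rewrite -!(pmulrn 1 q) ge_max => /andP[qq1 q110] gaq qQ.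
have q110' : (2 ^ k <= q)%N by rewrite -(ler_nat R) natrX.
have q2 : (2 < q)%N.
  by apply: leq_trans q110'; rewrite -{1}[2%N]expn1 ltn_exp2l // kE.
have q0 : (0 < q)%N by apply: leq_trans q2.
have qR0 : 0 < q%:R :> R by rewrite ltr0n.
have qR1 : 1 <= q%:R :> R by rewrite ler1n.
set X : R := Q%:~R `^ (1 / 4).
have QR : q%:R <= Q%:~R :> R.
  apply: le_trans qQ; apply: le1r_powR => //; lra.
have QR0 : 0 < Q%:~R :> R by apply: lt_le_trans QR.
have X0 : 0 <= X by exact: powR_ge0.
have X4 : X ^+ 4 = Q%:~R.
  rewrite -powR_mulrn // -powRrM.
  have -> : 1 / 4 * 4%:R = 1 :> R by lra.
  by rewrite powRr1 // ltW.
have [qX|Xq] := leP (q%:R : R) (2 * X).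
  exists a, 0, 0, 0, q%:Z, 1, 1, 1.
  have X1 : 1 <= 2 * X by apply: le_trans qX.
  do !split => //.
  rewrite -!(pmulrn 1 q) subrr !mul0r !subr0 normr0.
  by rewrite divr_ge0 // mulr_ge0 // ltW.
have /andP[YX XY] := truncn_itv X0; set Y := Num.trunc X in YX XY.
pose L := (trunc_log 2 q).+1.
have L110 : (110 <= L)%N by rewrite -kE; apply/leqW/trunc_log_max.
have qL : (q < 2 ^ L)%N by apply: trunc_log_ltn.
have Yq : (Y.*2 < q)%N.
  rewrite -(ltr_nat R) -mul2n natrM; apply: le_lt_trans Xq.
  by rewrite ler_wpM2l.
(* The square root of [q^(2 + eps) <= Q] leaves a spare [q^(eps/2)] to absorb the power of [L]. *)
have X2 : q%:R * q%:R `^ (eps / 2) <= X ^+ 2 :> R.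
  have -> : X ^+ 2 = Q%:~R `^ (2^-1).
    rewrite -powR_mulrn // -powRrM; congr (_ `^ _); lra.
  have -> : q%:R * q%:R `^ (eps / 2) = (q%:R `^ (2 + eps)) `^ (2^-1) :> R.
    rewrite -powRrM -{1}(powRr1 (ltW qR0)) -powRD; last by rewrite (gt_eqF qR0) implybT.
    by congr (_ `^ _); lra.
  have h2 : 0 <= 2^-1 :> R by rewrite invr_ge0.
  by apply: (ge0_ler_powR h2 _ _ qQ); rewrite nnegrE ?powR_ge0 // ltW.
have qLY : (q * L ^ 16 <= Y ^ 2)%N.
  have H : q%:R * (4 * L%:R ^+ 16) <= X ^+ 2 :> R.
    by apply: le_trans X2; rewrite ler_wpM2l // Hq1.
  have X1 : 1 <= X.
    rewrite -(@expr_ge1 _ 2) //; apply: le_trans H.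
    have h1 : 1 <= L%:R ^+ 16 :> R by rewrite exprn_ege1 // ler1n.
    by nra.
  have Y1 : (0 < Y)%N.
    by rewrite -(ltr_nat R); move: XY; rewrite -natr1; lra.
  have Y1' : 1 <= Y%:R :> R by rewrite ler1n.
  (* From [X < Y + 1 <= 2Y]. *)
  have XY2 : X ^+ 2 <= 4 * Y%:R ^+ 2.
    by move: XY; rewrite -natr1 => XY; nra.
  by rewrite -(ler_nat R) natrM !natrX; lra.
have [c cc ac] := exists_invz_mod q0 gaq.
have [p1 [p2 [p3 [x [[pp1 pp2 pp3 up] [pb Yx E Dge]]]]]] :=
  exists_prime_product_mod L110 q2 qLY qL (ltn_trans Yq qL) cc.
move: pb => /= /and4P[/andP[x1 p1Y] /andP[x2 p2Y] /andP[x3 p3Y] _].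
have x0 : (0 < x)%N by apply: leq_ltn_trans Yx.
have cx p : prime p -> (x < p)%N -> coprime p x.
  by move=> pp xp; rewrite prime_coprime // gtnNdvd.
move: up; rewrite /= !inE andbT negb_or => /andP[/andP[n12 n13] n23].
have cp p r : prime p -> prime r -> p != r -> coprime p r.
  by move=> pp pr pnr; rewrite prime_coprime // dvdn_prime2.
have [m mE] : exists m, a * (p1 * p2 * p3 * x)%N%:Z - 1 = m * q%:Z.
  apply/dvdzP.
  have -> : a * (p1 * p2 * p3 * x)%N%:Z - 1 =
     a * ((p1 * p2 * p3 * x)%N%:Z - c%:Z) + (a * c%:Z - 1) by ring.
  rewrite rpredD // dvdz_mull // -eqz_mod_dvd !modz_nat eqz_nat; exact/eqP.
have [||||a1 [a2 [a3 [a4 appr]]]] := @approx_of_product R q p1 p2 p3 x a m _ _ _ _ mE.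
- by split=> //; exact: prime_gt0.
- by rewrite !coprimeMr (cp p1 p2) // (cp p1 p3) // cx.
- by rewrite coprimeMr (cp p2 p3) // cx.
- exact: cx.
have bound (p : nat) : (0 < p)%N -> (p <= Y.*2)%N -> 1 <= p%:Z /\ p%:~R <= 2 * X.
  move=> p0 pY; split; first by rewrite lez_nat.
  rewrite -(pmulrn 1 p); apply: le_trans (_ : 2 * Y%:R <= _).
    by rewrite -natrM mul2n ler_nat.
  by rewrite ler_wpM2l.
exists a1, a2, a3, a4, p1, p2, p3, x.
split; first by apply: bound p1Y; exact: prime_gt0.
split; first by apply: bound p2Y; exact: prime_gt0.
split; first by apply: bound p3Y; exact: prime_gt0.
split; first by apply: bound => //; apply: leq_trans (ltnW x1) p1Y.
rewrite -!(pmulrn 1) appr.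
set D := (p1 * _ * _ * _)%N in Dge *.
(* All four factors of [D] exceed [Y], so [D >= (Y + 1)^4 >= X^4 = Q]. *)
have DQ : Q%:~R <= D%:R :> R.
  rewrite -X4; apply: (@le_trans _ _ (Y.+1%:R ^+ 4)).
    by apply: lerXn2r; rewrite ?nnegrE // ltW.
  by rewrite -natrX ler_nat.
have D0 : 0 < D%:R :> R by apply: lt_le_trans DQ.
have qD0 : 0 < q%:R * D%:R :> R by exact: mulr_gt0.
rewrite ger0_norm; last by rewrite invr_ge0 ltW.
by rewrite div1r lef_pV2 ?posrE ?mulr_gt0 // ler_pM2l.
Qed.
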